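(* Let $d$ be an integer with $1\le d<q$, and let $r=\sum_{a=1}^{i}\binom{m+d-a}{d-1}-t$ for some positive integer $i\le m+1$ and some nonnegative integer $t<d$. Then $$e_r(d,m)=\mathsf{p}_{m-i}+t\quad\text{and consequently}\quad d_r(\mathrm{PRM}_q(d,m))=\mathsf{p}_m-\mathsf{p}_{m-i}-t.$$
   Context: Let $q$ be a prime power, $\mathbb{F}_q$ the finite field with $q$ elements, $m$ a positive integer. For $j\in\mathbb{Z}$, $\mathsf{p}_j=q^j+\dots+q+1$ if $j\ge0$ and $\mathsf{p}_j=0$ if $j<0$ (so $\mathsf{p}_m=|\mathbb{P}^m(\mathbb{F}_q)|$). $e_r(d,m)$ is the maximum, over all families of $r$ linearly independent homogeneous polynomials of degree $d$ in $\mathbb{F}_q[x_0,\dots,x_m]$, of the number of points of $\mathbb{P}^m(\mathbb{F}_q)$ at which all of them vanish. Fix representatives $P_1,\dots,P_{\mathsf{p}_m}\in\mathbb{F}_q^{m+1}$ of the points of $\mathbb{P}^m(\mathbb{F}_q)$. The projective Reed–Muller code $\mathrm{PRM}_q(d,m)$ is the image of the space of homogeneous degree-$d$ polynomials under $F\mapsto(F(P_1),\dots,F(P_{\mathsf{p}_m}))$. For a linear code $C\subseteq\mathbb{F}_q^n$ of dimension $k$ and $1\le r\le k$, the $r$-th generalized Hamming weight is $d_r(C)=\min\{|\mathrm{Supp}(D)|: D\subseteq C \text{ a subspace}, \dim D=r\}$, where $\mathrm{Supp}(D)=\{i: c_i\neq0\text{ for some }c\in D\}$. *)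

(* Defs.v *)
From HB Require Import structures.
From mathcomp Require Import all_boot all_order all_algebra all_field.
From mathcomp Require Import mpoly.
Set Implicit Arguments. Unset Strict Implicit. Unset Printing Implicit Defensive.
Import Order.TTheory GRing.Theory.
Local Open Scope ring_scope.

Definition pj (q : nat) (j : int) : nat :=
  match j with
  | Posz n => (\sum_(k < n.+1) q ^ k)%N
  | Negz _ => 0%N
  end.

Section Proj.
Variables (F : finFieldType) (m : nat).

Definition vec := {ffun 'I_m.+1 -> F}.

(* Fixed representatives of the points of P^m(F_q): the nonzero vectors whose
   first nonzero coordinate equals 1. *)
Definition proj_pts : {set vec} :=
  [set v : vec | [exists i : 'I_m.+1,
                   (v i == 1) && [forall j : 'I_m.+1, (j < i)%N ==> (v j == 0)]]].

Definition nzeros (r : nat) (f : 'I_r -> {mpoly F[m.+1]}) : nat :=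
  #|[set v in proj_pts | [forall k : 'I_r, (f k).@[v] == 0]]|.

Definition lin_indep (r : nat) (f : 'I_r -> {mpoly F[m.+1]}) : Prop :=
  forall c : 'I_r -> F, \sum_(k < r) c k *: f k = 0 -> forall k, c k = 0.

Definition is_e_r (d r e : nat) : Prop :=
  (exists f : 'I_r -> {mpoly F[m.+1]},
      (forall k, f k \is d.-homog) /\ lin_indep f /\ nzeros f = e)
  /\ (forall f : 'I_r -> {mpoly F[m.+1]},
      (forall k, f k \is d.-homog) -> lin_indep f -> (nzeros f <= e)%N).

Definition Npts : nat := #|proj_pts|.

Definition ev (p : {mpoly F[m.+1]}) : 'rV[F]_Npts :=
  \row_(j < Npts) p.@[enum_val j].

Definition PRM (d : nat) : 'rV[F]_Npts -> Prop :=
  fun c => exists p : {mpoly F[m.+1]}, p \is d.-homog /\ c = ev p.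

End Proj.

Definition supp (F : finFieldType) (N : nat) (D : {vspace 'rV[F]_N}) : {set 'I_N} :=
  [set i : 'I_N | [exists c : 'rV[F]_N, (c \in D) && (c 0 i != 0)]].

Definition is_ghw (F : finFieldType) (N : nat) (C : 'rV[F]_N -> Prop) (r w : nat) : Prop :=
  (exists D : {vspace 'rV[F]_N},
      \dim D = r /\ (forall c, c \in D -> C c) /\ #|supp D| = w)
  /\ (forall D : {vspace 'rV[F]_N},
      \dim D = r -> (forall c, c \in D -> C c) -> (w <= #|supp D|)%N).

(* Main.v *)
(* Let H_X(d) be the rank of the evaluation map of degree-d forms on a finite
   point set X.  Since r independent forms vanishing on X force
   H_X(d) <= C(m+d,d) - r = C(j+d,d) + t with j = m - i, the upper bound says that
   p_j + s points with s <= d < q satisfy H_X(d) >= C(j+d,d) + s.  Averaging over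
   all hyperplanes yields one that contains at most p_(j-1) points of X, so some
   affine chart contains a set Y of at least q^j + s points of X.  For an affine
   set Y, H_Y(d) is at least the number of x < |Y| whose base-q digit sum is at
   most d: slice Y by a pencil of parallel hyperplanes, taken in the order of
   decreasing number of points, and use that the k-th slice may be tested with
   forms of degree d - k only.  This reduces to a numerical inequality, which an
   induction on the number of digits further reduces to a comparison of a Young
   diagram with the row-by-row filling of a q x q square.
   Conversely, the forms vanishing on P^j(F_q) and on t more points form a space
   of dimension at least r, and the upper bound shows that they have no further
   common zeros. *)
Require Import Defs.
From HB Require Import structures.
From mathcomp Require Import all_boot all_order all_algebra all_field.
From mathcomp Require Import mpoly zify.
Set Implicit Arguments. Unset Strict Implicit. Unset Printing Implicit Defensive.
Import Order.TTheory GRing.Theory.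

(** * Sums, binomial coefficients and finite sets *)

Lemma sum_ltn_minn (g n : nat) : \sum_(k < n) ((k < g) : nat) = minn g n.
Proof.
elim: n => [|n IHn]; first by rewrite big_ord0 minn0.
by rewrite big_ord_recr /= IHn; lia.
Qed.

Lemma ltn_sum_downclosed (P : pred nat) (n l : nat) :
  (forall x y, x <= y < n -> P y -> P x) -> l < n ->
  (l < \sum_(k < n) (P k : nat)) = P l.
Proof.
move=> downP ltln; case: (boolP (P l)) => [Pl|/negP nPl].
  apply: (@leq_trans (\sum_(k < n) ((k < l.+1) : nat))).
    by rewrite sum_ltn_minn leq_min leqnn.
  by apply: leq_sum => k _; case: ltnP => // lekl; rewrite (@downP k l) //; lia.
apply/negbTE; rewrite -leqNgt; apply: (@leq_trans (\sum_(k < n) ((k < l) : nat))).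
  apply: leq_sum => k _; case: ltnP => [_|lelk]; first exact: leq_b1.
  by case: (boolP (P k)) => // /downP Pl; case: nPl; apply: Pl; rewrite lelk /=.
by rewrite sum_ltn_minn geq_minl.
Qed.

Lemma sum_gtn (i n : nat) : \sum_(j < n) ((i < j) : nat) = n - i.+1.
Proof.
elim: n => [|n IHn]; first by rewrite big_ord0.
by rewrite big_ord_recr /= IHn; lia.
Qed.

Lemma sum_bin_diag (j e : nat) : \sum_(k < e.+1) 'C(j + k, k) = 'C(j + e.+1, e).
Proof.
elim: e => [|e IHe]; first by rewrite big_ord_recr big_ord0 /= !bin0.
by rewrite big_ord_recr IHe /= [in RHS]addnS binS addnC.
Qed.

Lemma sum_bin_codim (m d i : nat) : 0 < d -> i <= m.+1 ->
  \sum_(1 <= a < i.+1) 'C(m + d - a, d - 1) + 'C(m.+1 - i + d - 1, d) = 'C(m + d, d).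
Proof.
case: d => // d _; elim: i => [|i IHi] lt_im.
  by rewrite big_geq // add0n subn0 addSn subn1.
rewrite big_nat_recr //= -(IHi (ltnW lt_im)) -addnA; congr (_ + _).
have -> : m.+1 - i + d.+1 - 1 = (m - i + d).+1 by lia.
have -> : m.+1 - i.+1 + d.+1 - 1 = m - i + d by lia.
have -> : m + d.+1 - i.+1 = m - i + d by lia.
by rewrite binS subn1 addnC.
Qed.

Lemma leq_sum_bin (m d i : nat) : 0 < m -> 0 < d -> 0 < i ->
  d <= \sum_(1 <= a < i.+1) 'C(m + d - a, d - 1).
Proof.
case: d => // d m_gt0 _ i_gt0; rewrite big_ltn // (leq_trans _ (leq_addr _ _)) //.
by rewrite subSS subn0 -{1}(binSn d) leq_bin2l //; lia.
Qed.

Lemma exists_decreasing_enum (T : finType) (x0 : T) (N : T -> nat) :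
  exists s : seq T, [/\ uniq s, size s = #|T|,
    forall k l, k <= l < #|T| -> N (nth x0 s l) <= N (nth x0 s k) &
    \sum_(k < #|T|) N (nth x0 s k) = \sum_x N x].
Proof.
pose leN x y := N y <= N x; exists (sort leN (enum T)).
have size_s : size (sort leN (enum T)) = #|T| by rewrite size_sort cardT.
split=> // [|k l /andP[le_kl lt_l]|]; first by rewrite sort_uniq enum_uniq.
  apply: (sorted_leq_nth (leT := leN)); rewrite ?inE ?size_s ?(leq_ltn_trans le_kl) //.
  - by move=> x y z yx zy; apply: leq_trans zy yx.
  - by move=> x; apply: leqnn.
  - by apply: sort_sorted => x y; apply: leq_total.
rewrite -size_s -(big_mkord xpredT (fun k => N (nth x0 _ k))) -(big_nth x0 xpredT N).
by rewrite (perm_big (enum T)) ?perm_sort // big_enum.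
Qed.

Lemma exists_set_between (T : finType) (A C : {set T}) (n : nat) :
  A \subset C -> #|A| <= n <= #|C| ->
  exists X : {set T}, [/\ A \subset X, X \subset C & #|X| = n].
Proof.
move=> sAC /andP[le_An le_nC].
have /card_geqP[s [uniq_s size_s sub_s]] : n - #|A| <= #|C :\: A|.
  by rewrite cardsDS // leq_sub2r.
have sBCA : [set x in s] \subset C :\: A by apply/subsetP => x; rewrite inE => /sub_s.
exists (A :|: [set x in s]); split; first exact: subsetUl.
  by rewrite subUset sAC (subset_trans sBCA) ?subsetDl.
rewrite cardsU (_ : A :&: _ = set0) ?cards0; last first.
  by apply/eqP; rewrite setI_eq0 disjoint_sym; move: sBCA; rewrite subsetD => /andP[].
by rewrite subn0 cardsE (card_uniqP uniq_s) size_s subnKC.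
Qed.

(** * Young diagrams in a square *)

(* A diagram inside the [q x q] square is given by its row lengths [lam y], for
   [y < q]; its cells are the [(x, y)] with [x < lam y]. *)
Section YoungDiagrams.
Variable q : nat.
Implicit Types lam mu : nat -> nat.

Definition conjugate lam (x : nat) : nat := \sum_(y < q) ((x < lam y) : nat).

Definition antidiag lam (l : nat) : nat :=
  \sum_(y < q) ((y <= l < y + lam y) : nat).

Lemma conjugate_anti lam x y : x <= y -> conjugate lam y <= conjugate lam x.
Proof. by move=> lexy; apply: leq_sum => l _; lia. Qed.

Lemma conjugate_leq lam x : conjugate lam x <= q.
Proof.
rewrite -[leqRHS]card_ord -sum1_card.
by apply: leq_sum => l _; apply: leq_b1.
Qed.

Lemma ltn_conjugate lam x y :
  (forall k l, k <= l < q -> lam l <= lam k) -> y < q ->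
  (y < conjugate lam x) = (x < lam y).
Proof.
move=> lam_anti; apply: (@ltn_sum_downclosed (fun y => x < lam y)).
by move=> k l /lam_anti le_lam /leq_trans; apply.
Qed.

Lemma sum_conjugate lam :
  (forall y, y < q -> lam y <= q) ->
  \sum_(x < q) conjugate lam x = \sum_(y < q) lam y.
Proof.
move=> lam_le; rewrite exchange_big /=; apply: eq_bigr => y _.
by rewrite sum_ltn_minn (minn_idPl _) ?lam_le.
Qed.

Lemma sum_antidiag lam (w : nat) :
  \sum_(l < w) antidiag lam l = \sum_(y < q) minn (lam y) (w - y).
Proof.
rewrite exchange_big /=; apply: eq_bigr => y _.
elim: w => [|w IHw]; first by rewrite big_ord0; lia.
by rewrite big_ord_recr /= IHw; lia.
Qed.

Lemma antidiag_leq lam (l : nat) : antidiag lam l <= l.+1.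
Proof.
apply: (@leq_trans (\sum_(y < q) ((y < l.+1) : nat))).
  by apply: leq_sum => y _; lia.
by rewrite sum_ltn_minn geq_minl.
Qed.

Lemma antidiag_mono lam mu (l : nat) :
  (forall y, lam y <= mu y) -> antidiag lam l <= antidiag mu l.
Proof. by move=> le_lam; apply: leq_sum => y _; have := le_lam y; lia. Qed.

Definition full_rows (r y : nat) : nat := if y < r then q else 0.

Lemma antidiag_full_rows (r l : nat) :
  antidiag (full_rows r) l = minn l.+1 (minn q r) - (l.+1 - q).
Proof.
suff sumE n : \sum_(y < n) ((y <= l < y + full_rows r y) : nat)
               = minn l.+1 (minn n r) - (l.+1 - q) by apply: sumE.
rewrite /full_rows; elim: n => [|n IHn]; first by rewrite big_ord0; lia.
by rewrite big_ord_recr /= IHn; case: (ltnP n r) => ?; lia.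
Qed.

Definition row_fill (N y : nat) : nat := minn q (N - y * q).

Lemma sum_row_fill (N k : nat) : \sum_(y < k) row_fill N y = minn N (k * q).
Proof.
elim: k => [|k IHk]; first by rewrite big_ord0; lia.
by rewrite big_ord_recr /= IHk /row_fill; lia.
Qed.

Lemma row_fill_below (N y : nat) : y < N %/ q -> row_fill N y = q.
Proof. by move=> lty; rewrite /row_fill; have := divn_eq N q; nia. Qed.

Lemma row_fill_above (N y : nat) : 0 < q -> N %/ q < y -> row_fill N y = 0.
Proof.
move=> q_gt0 lty; rewrite /row_fill.
by have := divn_eq N q; have := ltn_pmod N q_gt0; nia.
Qed.

Lemma antidiag_row_fill (N l : nat) :
  let b := minn l.+1 (minn q (N %/ q)) - (l.+1 - q) in
  b <= antidiag (row_fill N) l <= b.+1.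
Proof.
have [q0|q_gt0] := posnP q.
  by rewrite /antidiag big1 => [|y _] /=; [lia | have := ltn_ord y; lia].
apply/andP; split.
  rewrite -antidiag_full_rows; apply: antidiag_mono => y; rewrite /full_rows.
  by case: ltnP => // /row_fill_below->.
apply: (@leq_trans (antidiag (full_rows (N %/ q).+1) l)).
  apply: antidiag_mono => y; rewrite /full_rows.
  by case: ltnP => [_|/(row_fill_above q_gt0)->]; rewrite // geq_minl.
by rewrite antidiag_full_rows; lia.
Qed.

Section Nonincreasing.
Variable lam : nat -> nat.
Hypothesis lam_anti : forall x y, x <= y -> lam y <= lam x.
Hypothesis lam_le : forall y, lam y <= q.

(* If row [k] ends before the antidiagonal [l], the cell of row [y] on [l.+1] is
   matched with the cell on [l] of row [y] for [y < k] and of row [y.-1] for [y > k]. *)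
Lemma antidiag_leqS (l : nat) :
  l < q -> antidiag lam l <= l -> antidiag lam l.+1 <= antidiag lam l.
Proof.
move=> ltlq small.
have [k lekl gapk] : exists2 k : 'I_q, k <= l & k + lam k <= l.
  case: (boolP [exists k : 'I_q, (k <= l) && (k + lam k <= l)]).
    by case/existsP=> k /andP[? ?]; exists k.
  rewrite negb_exists => /forallP nogap; suff: l < antidiag lam l by lia.
  apply: (@leq_trans (\sum_(y < q) ((y < l.+1) : nat))).
    by rewrite sum_ltn_minn; lia.
  by apply: leq_sum => y _; have := nogap y; lia.
have lt0q : q.-1 < q by lia.
rewrite /antidiag (bigD1_ord k) // [leqRHS](bigD1_ord (Ordinal lt0q)) //=.
rewrite (_ : (k <= l.+1 < k + lam k) = false) ?add0n; last by lia.
apply: leq_trans (leq_addl _ _); apply: leq_sum => y _; rewrite /bump.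
rewrite [q.-1 <= y]leqNgt ltn_ord /= add0n.
by have := @lam_anti y y.+1 (leqnSn y); case: (leqP k y); rewrite ?add1n ?add0n; lia.
Qed.

(* If row [k] has a cell on [l.+1], the cell of row [y] on [l.+1] is matched with the
   cell on [l] of row [y.-1] for [y <= k] and of row [y] for [y > k]; row [k] is left. *)
Lemma antidiag_ltnS (l : nat) :
  q <= l.+1 -> antidiag lam l.+1 <= (antidiag lam l).-1.
Proof.
move=> leql; have [->|] := posnP (antidiag lam l.+1); first by [].
rewrite lt0n sum_nat_eq0 negb_forall => /existsP[k]; rewrite /= eqb0 negbK => memk.
have ltkq := ltn_ord k; have q_gt0 : 0 < q by lia.
suff: antidiag lam l.+1 < antidiag lam l by lia.
rewrite /antidiag (bigD1_ord (Ordinal q_gt0)) // [ltnRHS](bigD1_ord k) //=.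
rewrite (_ : (k <= l < k + lam k)) ?add1n ?ltnS; last by have := ltn_ord k; lia.
rewrite (_ : (l.+1 < _) = false) ?add0n; last by have := lam_le 0; lia.
apply: leq_sum => y _; rewrite /bump /= add1n.
have := ltn_ord y; have := @lam_anti y y.+1 (leqnSn y).
by case: (leqP k y); rewrite ?add1n ?add0n; lia.
Qed.

Lemma antidiag_cross (N l0 l : nat) :
  antidiag lam l0 < antidiag (row_fill N) l0 -> l0 <= l ->
  antidiag lam l <= antidiag (row_fill N) l.
Proof.
move=> lt_l0 le_l0l; have /andP[_ fill_l0] := antidiag_row_fill N l0.
have /andP[fill_l _] := antidiag_row_fill N l; apply: leq_trans fill_l.
move: (minn q _) fill_l0 => r fill_l0.
suff : antidiag lam l <= antidiag lam l0 - ((l.+1 - q) - (l0.+1 - q)) by lia.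
rewrite -(subnK le_l0l) addnC; elim: (l - l0) => [|k IHk]; first by rewrite addn0; lia.
rewrite addnS; have [leqk|ltkq] := leqP q (l0 + k).+1.
  by have := antidiag_ltnS leqk; lia.
by have := antidiag_leq (row_fill N) l0; have := @antidiag_leqS (l0 + k); lia.
Qed.

(* Past the first antidiagonal on which [lam] has fewer cells than the
   row-by-row filling it never overtakes it again; as the totals agree, every
   prefix sum is at least that of the filling. *)
Lemma row_fill_leq_linear (N w : nat) :
  \sum_(y < q) lam y = N ->
  \sum_(y < q) minn (row_fill N y) (w - y) <= \sum_(y < q) minn (lam y) (w - y).
Proof.
move=> sum_lam; rewrite -!sum_antidiag leqNgt; apply/negP => lt_w.
have [l0 lt_l0] : exists l0 : 'I_w, antidiag lam l0 < antidiag (row_fill N) l0.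
  apply/existsP; apply: contraLR lt_w; rewrite negb_exists => /forallP ge.
  by rewrite -leqNgt; apply: leq_sum => l _; rewrite leqNgt ge.
have : \sum_(l < w + q.*2) antidiag lam l < \sum_(l < w + q.*2) antidiag (row_fill N) l.
  rewrite !big_split_ord /= -addSn leq_add // leq_sum // => l _.
  by apply: (antidiag_cross lt_l0); have := ltn_ord l0; lia.
rewrite !sum_antidiag ltnNge => /negP; apply.
rewrite (eq_bigr (fun y : 'I_q => row_fill N y)) => [|y _]; last first.
  by rewrite /row_fill; have := ltn_ord y; lia.
rewrite sum_row_fill (eq_bigr (fun y : 'I_q => lam y)) => [|y _].
  by rewrite sum_lam; lia.
by have := lam_le y; have := ltn_ord y; lia.
Qed.

(* The general weight [g] is compared with the linear one [y |-> w - y] that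
   agrees with it on the last, partially filled row. *)
Lemma row_fill_leq (g : nat -> nat) (N : nat) :
  (forall y, g y <= (g y.+1).+1) -> \sum_(y < q) lam y = N ->
  \sum_(y < q) minn (row_fill N y) (g y) <= \sum_(y < q) minn (lam y) (g y).
Proof.
move=> g_leS sum_lam; pose r := N %/ q; pose w := g r + r.
have g_leD y k : g y <= g (y + k) + k.
  elim: k => [|k IHk]; first by rewrite !addn0.
  by rewrite !addnS; have := g_leS (y + k); lia.
have row (y : 'I_q) : minn (row_fill N y) (g y) + minn (lam y) (w - y)
                      <= minn (lam y) (g y) + minn (row_fill N y) (w - y).
  have [lt_yr|lt_ry|->] := ltngtP y r; last by rewrite /w addnK; lia.
    rewrite row_fill_below //; have := lam_le y.
    by have := g_leD y (r - y); rewrite subnKC ?(ltnW lt_yr) // /w; lia.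
  rewrite row_fill_above ?(leq_ltn_trans _ (ltn_ord y)) //.
  by have := g_leD r (y - r); rewrite subnKC ?(ltnW lt_ry) // /w; lia.
rewrite -(leq_add2r (\sum_(y < q) minn (lam y) (w - y))).
apply: leq_trans (leq_add (leqnn _) (row_fill_leq_linear w sum_lam)).
by rewrite -!big_split /=; apply: leq_sum => y _; apply: row.
Qed.

End Nonincreasing.
End YoungDiagrams.

(** * Digit sums *)

Section DigitSums.
Variable q : nat.
Hypothesis q_gt0 : 0 < q.
Implicit Types p e N S : nat.

Fixpoint digit_sum p (x : nat) : nat :=
  if p is p'.+1 then x %% q + digit_sum p' (x %/ q) else 0.

Definition low_count p e N : nat := \sum_(x < N) ((digit_sum p x < e) : nat).

(* The number of [x < N] congruent to [l] modulo [q], for [l < q]. *)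
Definition residue_count N (l : nat) : nat := N %/ q + (l < N %% q).

Lemma digit_sum0 p : digit_sum p 0 = 0.
Proof. by elim: p => //= p IHp; rewrite mod0n div0n IHp. Qed.

Lemma digit_sum_small p x : x < q -> digit_sum p.+1 x = x.
Proof. by move=> ltxq; rewrite /= modn_small // divn_small // digit_sum0 addn0. Qed.

Lemma digit_sum_leqS p (x : nat) : digit_sum p x.+1 <= (digit_sum p x).+1.
Proof.
elim: p x => //= p IHp x; rewrite modnS divnS //; case: (q %| _) => //=.
by rewrite add0n add1n (leq_trans (IHp _)) // ltnS leq_addl.
Qed.

Lemma ltn_residue_count N l y : l < q -> (y < residue_count N l) = (y * q + l < N).
Proof.
move=> ltlq; rewrite /residue_count {3}(divn_eq N q); have := ltn_pmod N q_gt0.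
by case: (ltngtP y (N %/ q)) => [?|?|->]; case: ltnP; nia.
Qed.

Lemma residue_countMDl a N l : residue_count (a * q + N) l = a + residue_count N l.
Proof. by rewrite /residue_count divnMDl // modnMDl addnA. Qed.

Lemma residue_count_small N l : N <= q -> l < q -> residue_count N l = (l < N).
Proof.
rewrite leq_eqVlt => /predU1P[->|ltNq] ltlq; rewrite /residue_count.
  by rewrite divnn modnn q_gt0 ltlq.
by rewrite divn_small // modn_small.
Qed.

Lemma residue_countS N l :
  l < q -> residue_count N.+1 l = residue_count N l + (l == N %% q).
Proof.
move=> ltlq; have ltNq := ltn_pmod N q_gt0.
rewrite {1 2}(divn_eq N q) -addnS !residue_countMDl !residue_count_small ?(ltnW ltNq) //.
by rewrite ltnS -addnA; congr (_ + _); case: ltngtP.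
Qed.

Lemma sum_residue_count N : \sum_(l < q) residue_count N l = N.
Proof.
rewrite big_split /= sum_nat_const card_ord sum_ltn_minn.
by rewrite (minn_idPl (ltnW (ltn_pmod N q_gt0))) mulnC -divn_eq.
Qed.

Lemma residue_count_anti N k l : k <= l -> residue_count N l <= residue_count N k.
Proof. by rewrite /residue_count; lia. Qed.

Lemma residue_count_mono M N l : l < q -> M <= N -> residue_count M l <= residue_count N l.
Proof.
move=> ltlq leMN; case E: (residue_count M l) => [|y] //.
by rewrite ltn_residue_count // (leq_trans _ leMN) // -ltn_residue_count // E.
Qed.

Lemma residue_count_leq N a l : l < q -> N <= a * q -> residue_count N l <= a.
Proof.
move=> ltlq /(residue_count_mono ltlq)/leq_trans-> //.
by rewrite -[a * q]addn0 residue_countMDl residue_count_small // addn0.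
Qed.

Lemma conjugate_residue_count N y : conjugate q (residue_count N) y = row_fill q N y.
Proof.
rewrite /row_fill minnC -sum_ltn_minn; apply: eq_bigr => l _.
by rewrite ltn_residue_count // ltn_subRL.
Qed.

Lemma low_countS p e N :
  low_count p.+1 e N = \sum_(l < q) low_count p (e - l) (residue_count N l).
Proof.
elim: N => [|N IHN].
  by rewrite /low_count big_ord0 big1 // => l _; rewrite residue_count_small // big_ord0.
have ltNq := ltn_pmod N q_gt0.
rewrite {1}/low_count big_ord_recr /= -/(low_count p.+1 e N) IHN.
rewrite (bigD1 (Ordinal ltNq)) // [RHS](bigD1 (Ordinal ltNq)) //= addnAC.
congr (_ + _); last first.
  apply: eq_bigr => l /negPf; rewrite -val_eqE /= => neq.
  by rewrite residue_countS // neq addn0.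
rewrite residue_countS // eqxx addn1 {2}/low_count big_ord_recr /= -/(low_count _ _ _).
by congr (_ + _); rewrite /residue_count ltnn addn0; lia.
Qed.

Lemma low_countD p e S n :
  low_count p e (S + n) = low_count p e S + \sum_(y < n) ((digit_sum p (S + y) < e) : nat).
Proof. by rewrite /low_count big_split_ord. Qed.

Lemma low_count_mono p e M N : M <= N -> low_count p e M <= low_count p e N.
Proof. by move=> /subnKC<-; rewrite low_countD leq_addr. Qed.

Lemma low_count_small p e s : s <= e -> e <= q -> low_count p.+1 e s = s.
Proof.
move=> le_se le_eq; rewrite /low_count (eq_bigr (fun _ => 1)) => [|x _].
  by rewrite sum1_card card_ord.
by have ltxs := ltn_ord x; rewrite digit_sum_small; lia.
Qed.

Lemma sum_low_count_shift p e S (n : nat -> nat) :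
  e <= q -> (forall k l, k <= l < q -> n l <= n k) -> (forall l, l < q -> n l <= q) ->
  \sum_(l < q) low_count p (e - l) (S + n l) =
  \sum_(l < q) low_count p (e - l) S +
  \sum_(y < q) minn (conjugate q n y) (e - digit_sum p (S + y)).
Proof.
move=> le_eq n_anti n_le.
under eq_bigr do rewrite low_countD; rewrite big_split /=; congr (_ + _).
transitivity (\sum_(l < q) \sum_(y < q) ((y < n l) && (l < e - digit_sum p (S + y)) : nat)).
  apply: eq_bigr => l _.
  rewrite (big_ord_widen q (fun y => (digit_sum p (S + y) < e - l) : nat)) ?n_le //.
  by rewrite big_mkcond /=; apply: eq_bigr => y _; case: (y < n l); lia.
rewrite exchange_big /=; apply: eq_bigr => y _; set g := minn _ _.
rewrite (eq_bigr (fun l : 'I_q => (l < g) : nat)) => [|l _].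
  by rewrite sum_ltn_minn (minn_idPl _) // geq_min conjugate_leq.
by rewrite leq_min ltn_conjugate.
Qed.

Lemma low_count_leq_slices_spread p e (T : nat -> nat) :
  e <= q -> (forall k l, k <= l < q -> T l <= T k) -> T 0 <= T q.-1 + q ->
  low_count p.+1 e (\sum_(l < q) T l) <= \sum_(l < q) low_count p (e - l) (T l).
Proof.
move=> le_eq T_anti spread; pose S := T q.-1; pose n l := T l - S.
have n_anti k l : k <= l < q -> n l <= n k by move=> /T_anti; rewrite /n; lia.
have n_le l : l < q -> n l <= q by move=> ltlq; have := @T_anti 0 l; rewrite /n; lia.
have TE l : l < q -> T l = S + n l.
  by move=> ltlq; have := @T_anti l q.-1; rewrite /n -/S; lia.
pose M := \sum_(l < q) n l.
have -> : \sum_(l < q) T l = S * q + M.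
  rewrite mulnC -[q in q * S]card_ord -sum_nat_const -big_split /=.
  by apply: eq_bigr => l _; apply: TE.
have leMqq : M <= q * q.
  by rewrite -[q in q * _]card_ord -sum_nat_const; apply: leq_sum => l _; apply: n_le.
rewrite low_countS; under eq_bigr do rewrite residue_countMDl.
under [leqRHS]eq_bigr do rewrite TE //.
rewrite !sum_low_count_shift // => [|k l /andP[lekl _]|l ltlq]; first last.
- exact: residue_count_leq.
- exact: residue_count_anti.
rewrite leq_add2l; under eq_bigr do rewrite conjugate_residue_count.
apply: (row_fill_leq _ _ (g := fun y => e - digit_sum p (S + y))) => [x y|y|y|].
- exact: conjugate_anti.
- exact: conjugate_leq.
- by have := digit_sum_leqS p (S + y); rewrite addnS; lia.
- by rewrite sum_conjugate.
Qed.

(* Exchanging the slices with the classes modulo [q] of the lowest digit yields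
   [q] new slices whose sizes differ by at most [q]. *)
Lemma low_count_leq_slices p e (N : nat -> nat) :
  e <= q -> (forall k l, k <= l < q -> N l <= N k) ->
  (forall k, k < q -> N k <= q ^ p) ->
  low_count p.+1 e (\sum_(k < q) N k) <= \sum_(k < q) low_count p (e - k) (N k).
Proof.
elim: p e N => [|p IHp] e N le_eq N_anti N_le.
  by apply: low_count_leq_slices_spread => //; have := N_le 0; rewrite expn0; lia.
pose T l := \sum_(k < q) residue_count (N k) l.
have -> : \sum_(k < q) N k = \sum_(l < q) T l.
  by rewrite exchange_big /=; apply: eq_bigr => k _; rewrite sum_residue_count.
apply: (@leq_trans (\sum_(l < q) low_count p.+1 (e - l) (T l))).
  apply: low_count_leq_slices_spread => // [k l /andP[lekl _]|].
    by apply: leq_sum => i _; apply: residue_count_anti.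
  rewrite -[q in _ + q]card_ord -sum1_card -big_split /=.
  by apply: leq_sum => i _; rewrite /residue_count; lia.
apply: (@leq_trans (\sum_(l < q) \sum_(k < q) low_count p (e - l - k) (residue_count (N k) l))).
  apply: leq_sum => l _.
  apply: (IHp (e - l) (fun k => residue_count (N k) l)) => [|k k' /N_anti|k /N_le].
  - by rewrite (leq_trans (leq_subr _ _)).
  - exact: residue_count_mono.
  - by rewrite expnSr; apply: residue_count_leq.
rewrite exchange_big /=; apply: leq_sum => k _; rewrite low_countS.
by apply: leq_sum => l _; rewrite subnAC.
Qed.

Lemma leq_bin_low_count p j d s :
  j < p -> s <= d < q -> 'C(j + d, d) + s <= low_count p d.+1 (q ^ j + s).
Proof.
elim: j p d s => [|j IHj] [//|p] d s ltjp /andP[le_sd lt_dq].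
  by rewrite add0n binn expn0 low_count_small.
have residue_countE l : l < q -> residue_count (q ^ j.+1 + s) l = q ^ j + (l < s).
  move=> ltlq; rewrite expnSr residue_countMDl residue_count_small //.
  by rewrite ltnW // (leq_ltn_trans le_sd).
rewrite low_countS; under eq_bigr do rewrite residue_countE //.
have -> : 'C(j.+1 + d, d) + s = \sum_(l < d.+1) ('C(j + (d - l), d - l) + (l < s)).
  rewrite big_split /= sum_ltn_minn (minn_idPl (leqW le_sd)) addSnnS -sum_bin_diag.
  congr (_ + _); rewrite (reindex_inj rev_ord_inj) /=.
  by apply: eq_bigr => l _; rewrite subSS.
rewrite (big_ord_widen q (fun l => 'C(j + (d - l), d - l) + (l < s))) // big_mkcond.
apply: leq_sum => l _; case: ifP => // le_ld; rewrite subSn //.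
by apply: IHj => //; lia.
Qed.

End DigitSums.

(** * Dimension counts *)

Local Open Scope ring_scope.

Section LinearAlgebra.
Variable K : fieldType.
Implicit Types aT rT : vectType K.

Lemma dimv_lpreim_leq aT rT (f : 'Hom(aT, rT)) (A : {vspace aT}) (U V : {vspace rT}) :
  (f @: A <= U)%VS -> (V <= U)%VS ->
  (\dim A + \dim V <= \dim U + \dim (A :&: f @^-1: V))%N.
Proof.
move=> sfAU sVU; set P := (f @^-1: V)%VS.
have le_sum : (\dim (f @: A + V) <= \dim U)%N by rewrite dimvS // subv_add sfAU.
have le_ker : (\dim (A :&: lker f) <= \dim (A :&: P :&: lker f))%N.
  apply/dimvS/subvP => v; rewrite !memv_cap => /andP[-> vker] /=; rewrite vker andbT.
  by move: vker; rewrite memv_ker -memv_preim => /eqP->; rewrite mem0v.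
have le_img : (\dim (f @: A :&: V) <= \dim (f @: (A :&: P)))%N.
  apply/dimvS/subvP => w; rewrite memv_cap => /andP[/memv_imgP[v Av ->] fvV].
  by rewrite memv_img // memv_cap Av -memv_preim.
have := dimv_sum_cap (f @: A) V; have := limg_ker_dim f A.
by have := limg_ker_dim f (A :&: P); lia.
Qed.

Lemma dimv_cap_lker_leq aT (I : finType) (A : {set I}) (f : I -> 'Hom(aT, K^o))
    (U : {vspace aT}) :
  (\dim U <= \dim (U :&: \bigcap_(i in A) lker (f i)) + #|A|)%N.
Proof.
rewrite cardE -big_enum; elim: (enum A) U => [|i s IHs] U /=.
  by rewrite big_nil capvf addn0.
have le_img : (\dim (f i @: U) <= 1)%N by rewrite (leq_trans (dimvS (subvf _))) ?dimvf.
have := limg_ker_dim (f i) U; have := IHs (U :&: lker (f i))%VS.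
by rewrite big_cons capvA /=; lia.
Qed.

Lemma free_mktupleP aT r (g : 'I_r -> aT) :
  free [tuple g k | k < r] <->
  forall c : 'I_r -> K, \sum_(k < r) c k *: g k = 0 -> forall k, c k = 0.
Proof.
have sumE c : \sum_(k < r) c k *: [tuple g k | k < r]`_k = \sum_(k < r) c k *: g k.
  by apply: eq_bigr => k _; rewrite -tnth_nth tnth_mktuple.
split=> [/freeP g_free c | g_free]; first by rewrite -sumE; apply: g_free.
by apply/freeP => c; rewrite sumE; apply: g_free.
Qed.

Lemma exists_free_tuple aT (U : {vspace aT}) r : (r <= \dim U)%N ->
  exists2 g : 'I_r -> aT, free [tuple g k | k < r] & forall k, g k \in U.
Proof.
move=> le_rU; exists (fun k => (vbasis U)`_k) => [|k]; last first.
  by rewrite vbasis_mem // mem_nth // size_tuple (leq_trans (ltn_ord k)).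
have <- : take r (vbasis U) = [tuple (vbasis U)`_k | k < r] :> seq aT.
  apply: (@eq_from_nth _ 0) => [|k]; rewrite size_takel ?size_tuple // => ltkr.
  by rewrite nth_take // -(tnth_nth 0 [tuple _ | _ < r] (Ordinal ltkr)) tnth_mktuple.
apply: (@catl_free _ _ (drop r (vbasis U))).
by rewrite cat_take_drop (basis_free (vbasisP U)).
Qed.

End LinearAlgebra.

(** * Hilbert functions of finite point sets *)

Section HilbertFunction.
Variables (F : finFieldType) (m : nat).
Local Notation V := (vec F m).
Local Notation form d := (dhomog m.+1 F d).
Implicit Types (X Y : {set V}) (v w : V) (d e k : nat) (f h l : {mpoly F[m.+1]}).

Definition zeros f : {set V} := [set v : V | f.@[v] == 0].

Definition form_eval d v (p : form d) : F^o := (p : {mpoly F[m.+1]}).@[v].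

Lemma form_eval_is_linear d v : linear (@form_eval d v).
Proof.
move=> c p p'; rewrite /form_eval (linearP (@mpoly_of_dhomog m.+1 F d)).
by rewrite mevalD mevalZ.
Qed.
HB.instance Definition _ d v :=
  GRing.isLinear.Build F (form d) F^o _ (@form_eval d v) (@form_eval_is_linear d v).

Definition vanishing X d : {vspace form d} :=
  (\bigcap_(v in X) lker (linfun (@form_eval d v)))%VS.

(* [hilbert X d.+1] is the value at [d] of the Hilbert function of [X]; the shift
   makes the value at degree [-1] available as [hilbert X 0 = 0]. *)
Definition hilbert X e : nat :=
  if e is d.+1 then (\dim {:form d} - \dim (vanishing X d))%N else 0%N.

Lemma dim_form d : \dim {:form d} = 'C(m + d, d).
Proof. by rewrite dimvf addnC. Qed.

Lemma vanishingP X d (p : form d) :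
  reflect {in X, forall v, (p : {mpoly F[m.+1]}).@[v] = 0} (p \in vanishing X d).
Proof.
rewrite memvE; apply: (iffP subv_bigcapP) => p0 v Xv.
  by have := p0 v Xv; rewrite -memvE memv_ker lfunE => /eqP.
by rewrite -memvE memv_ker lfunE; apply/eqP/p0.
Qed.

Lemma vanishingS X Y d : X \subset Y -> (vanishing Y d <= vanishing X d)%VS.
Proof.
by move=> /subsetP sXY; apply/subvP => p /vanishingP p0; apply/vanishingP => v /sXY/p0.
Qed.

Lemma dim_vanishing_hilbert X d :
  (\dim (vanishing X d) + hilbert X d.+1 = 'C(m + d, d))%N.
Proof. by rewrite /= subnKC ?(dimvS (subvf _)) // dim_form. Qed.

Lemma hilbertS X Y e : X \subset Y -> (hilbert X e <= hilbert Y e)%N.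
Proof. by case: e => //= d sXY; rewrite leq_sub2l // dimvS // vanishingS. Qed.

Lemma hilbert_set0 e : hilbert set0 e = 0%N.
Proof.
case: e => //= d; apply/eqP; rewrite subn_eq0; apply/dimvS/subvP => p _.
by apply/vanishingP => v; rewrite inE.
Qed.

Lemma hilbert_leq_add X Y d : X \subset Y ->
  (hilbert Y d.+1 <= hilbert X d.+1 + #|Y :\: X|)%N.
Proof.
move=> /setIidPr sXY.
have le_dim : (\dim (vanishing X d) <= \dim (vanishing Y d) + #|Y :\: X|)%N.
  by rewrite [vanishing Y d](big_setID X) sXY; apply: dimv_cap_lker_leq.
by have := dim_vanishing_hilbert X d; have := dim_vanishing_hilbert Y d; lia.
Qed.

Lemma hilbert_gt0 h Y d v :
  h \is 1.-homog -> v \in Y -> h.@[v] != 0 -> (0 < hilbert Y d.+1)%N.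
Proof.
move=> homh Yv hv; rewrite /= subn_gt0 ltn_neqAle dimvS ?subvf // andbT.
apply: contraNneq hv => Edim; have Efull : vanishing Y d = fullv.
  by apply/eqP; rewrite eqEdim subvf Edim leqnn.
have homhd : h ^+ d \is d.-homog by rewrite -[X in X.-homog]mul1n dhomogMn.
have /vanishingP/(_ v Yv) : DHomog homhd \in vanishing Y d by rewrite Efull memvf.
by rewrite rmorphXn /= => /eqP; rewrite expf_eq0 => /andP[].
Qed.

Section Multiplication.
Variables (f : {mpoly F[m.+1]}) (k d : nat).
Hypothesis homf : f \is k.-homog.

Definition form_mul (p : form d) : form (k + d) :=
  DHomog (dhomogM homf (dhomog_is_dhomog p)).

Lemma form_mul_is_linear : linear form_mul.
Proof. by move=> c p p'; apply: val_inj; rewrite /= mulrDr scalerAr. Qed.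
HB.instance Definition _ :=
  GRing.isLinear.Build F (form d) (form (k + d)) _ form_mul form_mul_is_linear.

End Multiplication.

(* Multiplication by [f] embeds the forms modulo those vanishing on [X :\: zeros f]
   into the forms vanishing on [X :&: zeros f] modulo those vanishing on [X]. *)
Lemma leq_hilbert_split f k X e : f \is k.-homog ->
  (hilbert (X :&: zeros f) e + hilbert (X :\: zeros f) (e - k) <= hilbert X e)%N.
Proof.
move=> homf; have sIX : X :&: zeros f \subset X by apply: subsetIl.
case: (leqP e k) => [/eqP->|]; first by rewrite addn0 hilbertS.
case: e => // d; rewrite ltnS => /subnKC; set d' := (d - k)%N => <-.
rewrite -addnS addKn addnS; pose mulf := linfun (@form_mul f k d' homf).
have mulfE p v : (mulf p : {mpoly F[m.+1]}).@[v] = f.@[v] * (p : {mpoly F[m.+1]}).@[v].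
  by rewrite lfunE /= mevalM.
have smulf : (mulf @: fullv <= vanishing (X :&: zeros f) (k + d'))%VS.
  apply/subvP => _ /memv_imgP[p _ ->]; apply/vanishingP => v.
  by rewrite !inE mulfE => /andP[_ /eqP->]; rewrite mul0r.
have spre : (mulf @^-1: vanishing X (k + d') <= vanishing (X :\: zeros f) d')%VS.
  apply/subvP => p; rewrite -memv_preim => /vanishingP p0; apply/vanishingP => v.
  rewrite !inE => /andP[/negPf nzf /p0/eqP].
  by rewrite mulfE mulf_eq0 nzf => /eqP.
have le_dim : ('C(m + d', d') + \dim (vanishing X (k + d'))
    <= \dim (vanishing (X :&: zeros f) (k + d')) + \dim (vanishing (X :\: zeros f) d'))%N.
  rewrite -dim_form (leq_trans (dimv_lpreim_leq smulf (vanishingS (k + d') sIX))) //.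
  by rewrite capfv leq_add2l dimvS.
have := dim_vanishing_hilbert (X :\: zeros f) d'; move: le_dim.
have := dim_vanishing_hilbert (X :&: zeros f) (k + d').
by have := dim_vanishing_hilbert X (k + d'); lia.
Qed.

Section Slices.
Variables h l : {mpoly F[m.+1]}.
Hypotheses (homh : h \is 1.-homog) (homl : l \is 1.-homog).

Definition slice Y (c : F) : {set V} := [set v in Y | l.@[v] / h.@[v] == c].

Lemma sub_slice Y c : slice Y c \subset Y.
Proof. by apply/subsetP => v; rewrite inE => /andP[]. Qed.

Lemma card_slices Y : (\sum_(c : F) #|slice Y c| = #|Y|)%N.
Proof.
rewrite -[RHS]sum1_card (partition_big (fun v => l.@[v] / h.@[v]) xpredT) //=.
by apply: eq_bigr => c _; rewrite -sum1_card; apply: eq_bigl => v; rewrite inE.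
Qed.

Lemma leq_hilbert_slices (cs : seq F) Y e :
  uniq cs -> {in Y, forall v, h.@[v] != 0} ->
  (\sum_(k < size cs) hilbert (slice Y (nth 0%R cs k)) (e - k) <= hilbert Y e)%N.
Proof.
elim: cs Y e => [|c cs IHcs] Y e /=; first by rewrite big_ord0.
case/andP=> cNcs ucs hY; rewrite big_ord_recl /= subn0.
pose f := l - c *: h; have homf : f \is 1.-homog by rewrite rpredB ?rpredZ.
have in_zeros v : v \in Y -> (v \in zeros f) = (l.@[v] / h.@[v] == c).
  by move=> /hY nzh; rewrite inE mevalB mevalZ subr_eq0 (can2_eq (divfK nzh) (mulfK nzh)).
apply: leq_trans (leq_hilbert_split Y e homf); rewrite leq_add //.
  by apply/hilbertS/subsetP => v; rewrite in_setI inE => /andP[Yv]; rewrite in_zeros ?Yv.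
have sDY : Y :\: zeros f \subset Y by apply: subsetDl.
apply: leq_trans (IHcs _ _ ucs _); last by move=> v /(subsetP sDY)/hY.
apply: leq_sum => k _; rewrite /bump /= subnDA add0n.
apply/hilbertS/subsetP => v; rewrite inE => /andP[Yv /eqP Ev].
rewrite inE in_setD in_zeros // Ev Yv eqxx !andbT.
by apply: contraNneq cNcs => <-; rewrite mem_nth.
Qed.

End Slices.

Definition affine_coords h (ls : seq {mpoly F[m.+1]}) v : seq F :=
  [seq l.@[v] / h.@[v] | l <- ls].

Lemma slice_affine_coords_inj h l ls Y c :
  {in Y &, injective (affine_coords h (l :: ls))} ->
  {in slice h l Y c &, injective (affine_coords h ls)}.
Proof.
move=> inj v w; rewrite !inE => /andP[Yv /eqP lv] /andP[Yw /eqP lw] Evw.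
by apply: inj => //=; rewrite lv lw Evw.
Qed.

Lemma card_affine_coords_leq h ls Y :
  {in Y &, injective (affine_coords h ls)} -> (#|Y| <= #|F| ^ size ls)%N.
Proof.
move=> inj; rewrite -card_tuple.
apply: (@leq_card_in _ _ (fun v => [tuple of map (fun l => l.@[v] / h.@[v]) (in_tuple ls)])).
by move=> v w Yv Yw /(congr1 val); apply: inj.
Qed.

(* The slices are peeled off in the order of decreasing number of points; each
   one costs a factor of degree [1], so the [k]-th is tested in degree [d - k]. *)
Lemma low_count_leq_hilbert_affine h ls Y e :
  (e <= #|F|)%N -> h \is 1.-homog -> {in ls, forall l, l \is 1.-homog} ->
  {in Y, forall v, h.@[v] != 0} -> {in Y &, injective (affine_coords h ls)} ->
  (low_count #|F| (size ls) e #|Y| <= hilbert Y e)%N.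
Proof.
move=> + homh; elim: ls Y e => [|l ls IHls] Y e le_eq homls hY inj.
  have := card_affine_coords_leq inj; rewrite /= expn0.
  case: (set_0Vmem Y) => [->|[v Yv]]; first by rewrite cards0 /low_count big_ord0.
  rewrite leq_eqVlt ltnS leqn0 cards_eq0 => /predU1P[->|/eqP Y0].
    case: e le_eq => [|e] _; rewrite /low_count big_ord1 //=.
    exact: hilbert_gt0 homh Yv (hY v Yv).
  by rewrite Y0 inE in Yv.
rewrite -(card_slices h l Y); have q_gt0 : (0 < #|F|)%N := ltnW (finNzRing_gt1 F).
have homl : l \is 1.-homog by apply: homls; rewrite mem_head.
have [cs [uniq_cs size_cs decr_cs <-]] :=
  exists_decreasing_enum 0 (fun c => #|slice h l Y c|).
apply: leq_trans (low_count_leq_slices q_gt0 le_eq decr_cs _) _ => [k _|].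
  exact/card_affine_coords_leq/slice_affine_coords_inj.
apply: leq_trans (leq_hilbert_slices homh homl e uniq_cs hY).
rewrite size_cs; apply: leq_sum => k _; apply: IHls => [|l' ls_l'||].
- by rewrite (leq_trans (leq_subr _ _)).
- by apply: homls; rewrite inE ls_l' orbT.
- by move=> v /(subsetP (sub_slice _ _ _ _))/hY.
- exact: slice_affine_coords_inj.
Qed.

End HilbertFunction.

(** * Points of the projective space *)

(* The number of points of P^(k-1)(F_q). *)
Definition nproj (q k : nat) : nat := \sum_(l < k) q ^ l.

Lemma nproj0 (q : nat) : nproj q 0 = 0%N.
Proof. by rewrite /nproj big_ord0. Qed.

Lemma nprojSr (q k : nat) : nproj q k.+1 = (nproj q k + q ^ k)%N.
Proof. by rewrite /nproj big_ord_recr. Qed.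

Lemma nprojS (q k : nat) : nproj q k.+1 = (q * nproj q k).+1.
Proof.
rewrite /nproj big_ord_recl big_distrr /= expn0 add1n; congr _.+1.
by apply: eq_bigr => l _; rewrite -expnS.
Qed.

Lemma nproj_mono (q j k : nat) : (j <= k)%N -> (nproj q j <= nproj q k)%N.
Proof. by move=> /subnKC<-; rewrite /nproj big_split_ord leq_addr. Qed.

Lemma pj_nproj (q m i : nat) : (i <= m.+1)%N -> pj q (m%:Z - i%:Z) = nproj q (m.+1 - i).
Proof.
rewrite leq_eqVlt => /predU1P[->|le_im].
  have -> : m%:Z - m.+1%:Z = Negz 0 by lia.
  by rewrite subnn nproj0.
have -> : m%:Z - i%:Z = (m - i)%N by lia.
by rewrite subSn.
Qed.

Lemma leq_bin_low_count_nproj (q p k d s N : nat) :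
  (k <= p.+1)%N -> (0 < d < q)%N -> (s <= d)%N ->
  (nproj q k + s <= N + nproj q k.-1)%N ->
  ('C(k + d - 1, d) + s <= low_count q p.+1 d.+1 N)%N.
Proof.
move=> le_kp /andP[d_gt0 lt_dq] le_sd; have q_gt0 : (0 < q)%N by lia.
case: k le_kp => [|k] lt_kp; rewrite /= ?nprojSr => le_N.
  rewrite bin_small; last by lia.
  rewrite -[leqLHS](low_count_small q_gt0 p _ lt_dq); last by lia.
  by apply: low_count_mono; lia.
rewrite addSn subn1 (leq_trans (leq_bin_low_count q_gt0 lt_kp _)) ?le_sd //.
by apply: low_count_mono; lia.
Qed.

Section Points.
Variables (F : finFieldType) (m : nat).
Local Notation V := (vec F m).
Local Notation q := #|F|.
Local Notation pts := (proj_pts F m).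
Implicit Types (X Y : {set V}) (v w : V) (h : {mpoly F[m.+1]}) (k d s : nat).

Definition cell (i : 'I_m.+1) : {set V} :=
  [set v : V | (v i == 1) && [forall j : 'I_m.+1, (j < i)%N ==> (v j == 0)]].

Lemma cellP i v :
  reflect (v i = 1 /\ forall j : 'I_m.+1, (j < i)%N -> v j = 0) (v \in cell i).
Proof.
rewrite inE; apply: (iffP andP) => -[/eqP vi v0]; split=> //.
  by move=> j ltji; apply/eqP/(implyP (forallP v0 j)).
by apply/forallP => j; apply/implyP => /v0->.
Qed.

Lemma proj_ptsP v : reflect (exists i, v \in cell i) (v \in pts).
Proof. by rewrite inE; apply: (iffP existsP) => -[i vi]; exists i; rewrite inE in vi *. Qed.

Lemma card_cell i : #|cell i| = (q ^ (m - i))%N.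
Proof.
pose A (j : 'I_m.+1) : {pred F} :=
  if (j < i)%N then pred1 0 else if j == i then pred1 1 else predT.
have -> : #|cell i| = #|family A|.
  apply: eq_card => v; apply/cellP/familyP => [[vi v0] j | vA].
    rewrite /A; case: ltnP => [/v0->|_]; first exact: eqxx.
    by case: eqP => [->|_]; rewrite inE ?vi.
  split=> [|j ltji]; first by have := vA i; rewrite /A ltnn eqxx inE => /eqP.
  by have := vA j; rewrite /A ltji inE => /eqP.
rewrite card_family foldrE big_map big_enum.
rewrite (eq_bigr (fun j : 'I_m.+1 => if (i < j)%N then q else 1%N)) => [|j _]; last first.
  by rewrite /A -val_eqE; case: ltngtP => _; rewrite ?card1 ?cardT.
rewrite -big_mkcond prod_nat_const; congr (_ ^ _)%N.
rewrite -sum1_card -subSS -sum_gtn big_mkcond.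
by apply: eq_bigr => j _; rewrite -[j \in _]/(i < j)%N; case: ltnP.
Qed.

Lemma cell_neq0 i v : v \in cell i -> exists j, v j != 0.
Proof. by case/cellP=> vi _; exists i; rewrite vi oner_eq0. Qed.

(* The projective subspace of dimension [k - 1] spanned by the last [k]
   coordinate points. *)
Definition linsp k : {set V} :=
  [set v in pts | [forall i : 'I_m.+1, (i + k < m.+1)%N ==> (v i == 0)]].

Lemma linspP k v :
  reflect (v \in pts /\ forall i : 'I_m.+1, (i + k < m.+1)%N -> v i = 0) (v \in linsp k).
Proof.
rewrite [v \in linsp k]inE; apply: (iffP andP) => -[pv v0]; split=> //.
  by move=> i lti; apply/eqP/(implyP (forallP v0 i)).
by apply/forallP => i; apply/implyP => /v0->.
Qed.

Lemma linsp_sub k : linsp k \subset pts.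
Proof. by apply/subsetP => v /linspP[]. Qed.

Lemma linspT : linsp m.+1 = pts.
Proof.
apply/eqP; rewrite eqEsubset linsp_sub; apply/subsetP => v pv.
by apply/linspP; split=> // i; lia.
Qed.

Lemma linsp0 : linsp 0 = set0.
Proof.
apply/setP => v; rewrite inE [in RHS]inE; apply/negP => /andP[/proj_ptsP[i /cellP[vi _]]].
by move/forallP/(_ i); rewrite addn0 ltn_ord vi oner_eq0.
Qed.

Lemma linspS k (i : 'I_m.+1) : (i + k = m)%N -> linsp k.+1 = linsp k :|: cell i.
Proof.
move=> Eik; apply/setP => v; rewrite in_setU.
apply/linspP/orP => [[pv v0]|[/linspP[pv v0]|iv]].
- have /proj_ptsP[j /cellP[vj vj0]] := pv.
  have [ltij|ltji|Eij] := ltngtP i j; last first.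
  + right; apply/cellP; rewrite (val_inj Eij : i = j); split=> // j' /vj0.
  + by have /eqP : v j = 0 by [apply: v0; lia]; rewrite vj oner_eq0.
  by left; apply/linspP; split=> // j' ltj'; apply: vj0; lia.
- by split=> // j ltj; apply: v0; lia.
split; first by apply/proj_ptsP; exists i.
by have /cellP[_ v0] := iv => j ltj; apply: v0; lia.
Qed.

Lemma card_linsp k : (k <= m.+1)%N -> #|linsp k| = nproj q k.
Proof.
elim: k => [|k IHk] ltkm; first by rewrite linsp0 cards0 nproj0.
have lt_i : (m - k < m.+1)%N by lia.
rewrite (@linspS _ (Ordinal lt_i)) /=; last by lia.
rewrite cardsU (_ : _ :&: _ = set0); last first.
  apply/setP => v; rewrite [in RHS]inE.
  apply/negP => /setIP[/linspP[_ v0] /cellP[vi _]].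
  by have /eqP : v (Ordinal lt_i) = 0 by [apply: v0; rewrite /=; lia]; rewrite vi oner_eq0.
by rewrite cards0 subn0 card_cell IHk ?(ltnW ltkm) // nprojSr subKn.
Qed.

Lemma Npts_nproj : Npts F m = nproj q m.+1.
Proof. by rewrite -card_linsp // linspT. Qed.

Definition linear_form (a : V) : {mpoly F[m.+1]} := \sum_i a i *: 'X_i.

Lemma linear_form_homog a : linear_form a \is 1.-homog.
Proof. by apply: rpred_sum => i _; rewrite rpredZ // dhomogX /= mdeg1. Qed.

Lemma meval_linear_form a v : (linear_form a).@[v] = \sum_i a i * v i.
Proof. by rewrite raddf_sum; apply: eq_bigr => i _ /=; rewrite mevalZ mevalXU. Qed.

Lemma linear_formD a b : linear_form (a + b) = linear_form a + linear_form b.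
Proof. by rewrite -big_split; apply: eq_bigr => i _ /=; rewrite ffunE scalerDl. Qed.

Lemma card_annihilator_leq v : (exists i, v i != 0) ->
  (#|[set a | v \in zeros (linear_form a)]| <= q ^ m)%N.
Proof.
case=> i nzvi; have q_gt0 : (0 < q)%N := ltnW (finNzRing_gt1 F).
rewrite -(leq_pmul2r q_gt0) -expnSr; set A := [set a | _].
pose axis (c : F) : V := [ffun j => c *+ (j == i)].
have axisE c : (linear_form (axis c)).@[v] = c * v i.
  rewrite meval_linear_form (bigD1 i) //= ffunE eqxx big1 ?addr0 // => j /negPf ji.
  by rewrite ffunE ji mul0r.
have inj : {in setX A [set: F] &, injective (fun ac => ac.1 + axis ac.2)}.
  move=> [a c] [b c']; rewrite !inE !andbT /= => /eqP a0 /eqP b0 Eab.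
  have := congr1 (fun a' => (linear_form a').@[v]) Eab.
  rewrite !linear_formD !mevalD !axisE a0 b0 !add0r => /(mulIf nzvi) Ec.
  by rewrite Ec in Eab *; congr (_, _); apply: addIr Eab.
rewrite -[X in (_ * X)%N]cardsT -cardsX -(card_in_imset inj) (leq_trans (max_card _)) //.
by rewrite card_ffun card_ord.
Qed.

Lemma sum_card_hyperplane_leq X : {in X, forall v, exists i, v i != 0} ->
  (\sum_(a : V) #|X :&: zeros (linear_form a)| <= #|X| * q ^ m)%N.
Proof.
move=> nzX; rewrite -sum_nat_const.
rewrite (eq_bigr (fun a : V => \sum_(v in X) (v \in zeros (linear_form a)))%N) => [|a _].
  rewrite exchange_big /=; apply: leq_sum => v Xv.
  rewrite (leq_trans _ (card_annihilator_leq (nzX v Xv))) // -sum1_card [leqRHS]big_mkcond /=.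
  by apply: leq_sum => a _; rewrite [a \in _]inE; case: (v \in zeros _).
rewrite -sum1_card big_mkcond [RHS]big_mkcond /=; apply: eq_bigr => v _.
by rewrite in_setI; case: (v \in X) => //=; case: (v \in zeros _).
Qed.

(* Averaging over all linear forms, of which at most [q ^ m] vanish at a given point. *)
Lemma exists_sparse_hyperplane X u :
  {in X, forall v, exists i, v i != 0} -> (#|X| <= q * u.+1)%N ->
  exists2 h : {mpoly F[m.+1]}, h \is 1.-homog & (#|X :&: zeros h| <= u)%N.
Proof.
move=> nzX leX; case: (boolP [exists a, #|X :&: zeros (linear_form a)| <= u]%N).
  by case/existsP=> a; exists (linear_form a) => //; apply: linear_form_homog.
rewrite negb_exists => /forallP dense; exfalso.
have zeros0 : zeros (linear_form 0) = setT.
  apply/setP => v; rewrite !inE meval_linear_form big1 ?eqxx // => i _.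
  by rewrite ffunE mul0r.
have low : (#|X| + (q ^ m.+1).-1 * u.+1 <= #|X| * q ^ m)%N.
  apply: leq_trans (sum_card_hyperplane_leq nzX).
  have <- : #|predC1 (0 : V)| = (q ^ m.+1).-1 by rewrite cardC1 card_ffun card_ord.
  rewrite (bigD1 (0 : V)) //= zeros0 setIT leq_add2l -sum_nat_const.
  by apply: leq_sum => a _; rewrite ltnNge.
have := leq_mul leX (leqnn (q ^ m).-1); move: low; rewrite expnS.
have : (0 < q ^ m)%N by rewrite expn_gt0 ltnW ?finNzRing_gt1.
case: (q ^ m)%N => // Q _; case: q (finNzRing_gt1 F) => // q' q'_gt0.
by rewrite mulnS /= mulnDl !mulnS; nia.
Qed.

Lemma proj_pts_affine_coords_inj h Y :
  Y \subset pts -> {in Y, forall v, h.@[v] != 0} ->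
  {in Y &, injective (affine_coords h [seq 'X_i | i <- enum 'I_m.+1])}.
Proof.
move=> /subsetP sY hY v w Yv Yw /eq_in_map Evw.
have hv := hY _ Yv; have hw := hY _ Yw.
have {Evw} prop i : v i * h.@[w] = w i * h.@[v].
  have /eqP := Evw 'X_i (map_f _ (mem_enum _ i)).
  by rewrite !mevalXU eqr_div // => /eqP.
have /proj_ptsP[i /cellP[vi v0]] := sY _ Yv; have /proj_ptsP[j /cellP[wj w0]] := sY _ Yw.
have [ltij|ltji|/val_inj Eij] := ltngtP i j.
- by have := prop i; rewrite vi w0 // mul1r mul0r => /eqP; rewrite (negPf hw).
- by have := prop j; rewrite wj v0 // mul1r mul0r => /esym/eqP; rewrite (negPf hv).
have := prop i; rewrite vi Eij wj !mul1r => Eh; apply/ffunP => k.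
by have := prop k; rewrite Eh => /(mulIf hv).
Qed.

Lemma low_count_leq_hilbert_proj h Y e :
  (e <= q)%N -> h \is 1.-homog -> Y \subset pts -> {in Y, forall v, h.@[v] != 0} ->
  (low_count q m.+1 e #|Y| <= hilbert Y e)%N.
Proof.
move=> le_eq homh sY hY.
have := low_count_leq_hilbert_affine le_eq homh _ hY (proj_pts_affine_coords_inj sY hY).
rewrite size_map size_enum_ord; apply=> _ /mapP[i _ ->].
by rewrite dhomogX /= mdeg1.
Qed.

(* A hyperplane meeting [X] in few points leaves a large affine part. *)
Lemma leq_bin_hilbert X k d s :
  (k <= m.+1)%N -> (0 < d < q)%N -> (s <= d)%N -> X \subset pts ->
  (nproj q k + s <= #|X|)%N -> ('C(k + d - 1, d) + s <= hilbert X d.+1)%N.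
Proof.
move=> le_km /andP[d_gt0 lt_dq] le_sd sX le_X.
have [|X0 [_ sX0 cardX0]] := @exists_set_between _ set0 X (nproj q k + s) (sub0set X).
  by rewrite cards0.
have [h homh sparse] : exists2 h : {mpoly F[m.+1]}, h \is 1.-homog
    & (#|X0 :&: zeros h| <= nproj q k.-1)%N.
  apply: exists_sparse_hyperplane => [v /(subsetP sX0)/(subsetP sX)/proj_ptsP[i]|].
    exact: cell_neq0.
  rewrite cardX0; case: (k) => [|k'].
    by rewrite nproj0 add0n muln1 ltnW // (leq_ltn_trans le_sd).
  by rewrite nprojS mulnS addSnnS addnC leq_add2r (leq_ltn_trans le_sd).
have cardY := cardsID (zeros h) X0; set Y := X0 :\: zeros h in cardY.
have sYX : Y \subset X by apply: subset_trans (subsetDl _ _) sX0.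
apply: leq_trans (hilbertS _ sYX).
apply: leq_trans (low_count_leq_hilbert_proj lt_dq homh _ _).
- by apply: leq_bin_low_count_nproj => //; lia.
- exact: subset_trans sYX sX.
- by move=> v; rewrite !inE => /andP[].
Qed.

End Points.

(** * Forms on a parametrized point set *)

Lemma dhomog_comp (R : comNzRingType) (n k d : nat) (p : {mpoly R[n]})
    (lq : n.-tuple {mpoly R[k]}) :
  p \is d.-homog -> (forall i, tnth lq i \is 1.-homog) -> p \mPo lq \is d.-homog.
Proof.
move=> /dhomogP homp homlq; rewrite comp_mpolyE big_seq rpred_sum // => mu /homp <-.
rewrite rpredZ //= mdegE; elim/big_ind2: _ => [|? ? ? ? ? ?|i _]; first exact: dhomog1.
  exact: dhomogM.
by have := dhomogMn (mu i) (homlq i); rewrite mul1n.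
Qed.

Section Parametrization.
Variables (F : finFieldType) (m k : nat) (lq : m.+1.-tuple {mpoly F[k.+1]}).
Hypothesis homlq : forall i, tnth lq i \is 1.-homog.

Definition form_comp d (p : dhomog m.+1 F d) : dhomog k.+1 F d :=
  DHomog (dhomog_comp (dhomog_is_dhomog p) homlq).

Lemma form_comp_is_linear d : linear (@form_comp d).
Proof. by move=> c p p'; apply: val_inj; rewrite /= linearP. Qed.
HB.instance Definition _ d :=
  GRing.isLinear.Build F (dhomog m.+1 F d) (dhomog k.+1 F d) _
    (@form_comp d) (@form_comp_is_linear d).

Lemma hilbert_leq_parametrized (X : {set vec F m}) (d : nat) :
  (forall v, v \in X -> exists w, forall i, v i = (tnth lq i).@[w]) ->
  (hilbert X d.+1 <= 'C(k + d, d))%N.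
Proof.
move=> paramX; pose phi := linfun (@form_comp d).
have sker : (lker phi <= vanishing X d)%VS.
  apply/subvP => p; rewrite memv_ker lfunE => /eqP/(congr1 val) /= p0.
  apply/vanishingP => v /paramX[w vE]; rewrite (meval_eq _ vE).
  by rewrite -comp_mpoly_meval p0 meval0.
have : ('C(m + d, d) <= \dim (vanishing X d) + 'C(k + d, d))%N.
  by rewrite -(dim_form F m) -(dim_form F k) -(limg_ker_dim phi) capfv leq_add ?dimvS ?subvf.
by have := dim_vanishing_hilbert X d; lia.
Qed.

End Parametrization.

Lemma hilbert_linsp_leq (F : finFieldType) (m k d : nat) : (0 < d)%N -> (k <= m.+1)%N ->
  (hilbert (linsp F m k) d.+1 <= 'C(k + d - 1, d))%N.
Proof.
case: k => [|k] d_gt0 le_km; first by rewrite linsp0 hilbert_set0.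
pose lq : m.+1.-tuple {mpoly F[k.+1]} :=
  [tuple if (i + k < m)%N then 0 else 'X_(inord (i + k - m)) | i < m.+1].
rewrite addSn subn1; apply: (@hilbert_leq_parametrized _ _ _ lq) => [i|v /linspP[_ v0]].
  by rewrite tnth_mktuple; case: ifP => _; rewrite ?rpred0 // dhomogX /= mdeg1.
exists (fun j => v (inord (j + m - k))) => i; rewrite tnth_mktuple.
case: ltnP => [lti|lei]; first by rewrite meval0 v0 //; lia.
rewrite mevalXU; congr (v _); apply: val_inj.
by rewrite /= !inordK //; have := ltn_ord i; lia.
Qed.

(** * Systems of forms and projective Reed-Muller codes *)

Section Systems.
Variables (F : finFieldType) (m : nat).
Local Notation V := (vec F m).
Local Notation q := #|F|.
Local Notation pts := (proj_pts F m).
Local Notation form d := (dhomog m.+1 F d).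
Implicit Types (X : {set V}) (v : V) (d r : nat).

Definition common_zeros r (f : 'I_r -> {mpoly F[m.+1]}) : {set V} :=
  [set v in pts | [forall k : 'I_r, (f k).@[v] == 0]].

Lemma common_zerosP r (f : 'I_r -> {mpoly F[m.+1]}) v :
  reflect (v \in pts /\ forall k, (f k).@[v] = 0) (v \in common_zeros f).
Proof.
rewrite [v \in common_zeros f]inE; apply: (iffP andP) => -[pv f0]; split=> //.
  by move=> k; apply/eqP/(forallP f0).
by apply/forallP => k; rewrite f0.
Qed.

Lemma common_zeros_sub r (f : 'I_r -> {mpoly F[m.+1]}) : common_zeros f \subset pts.
Proof. by apply/subsetP => v /common_zerosP[]. Qed.

Lemma lin_indep_free d r (g : 'I_r -> form d) :
  lin_indep (fun k => g k : {mpoly F[m.+1]}) <-> free [tuple g k | k < r].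
Proof.
have sumE c : val (\sum_(k < r) c k *: g k) = \sum_(k < r) c k *: (g k : {mpoly F[m.+1]}).
  by rewrite (raddf_sum (@mpoly_of_dhomog m.+1 F d)); apply: eq_bigr.
split=> [ind | /free_mktupleP ind c c0]; [apply/free_mktupleP => c c0 |]; apply: ind.
  by rewrite -sumE c0.
by apply: val_inj; rewrite sumE.
Qed.

Lemma lin_indep_vanishing_leq X d r (f : 'I_r -> {mpoly F[m.+1]}) :
  (forall k, f k \is d.-homog) -> lin_indep f ->
  (forall k, {in X, forall v, (f k).@[v] = 0}) ->
  (r + hilbert X d.+1 <= 'C(m + d, d))%N.
Proof.
move=> homf indf f0; pose g k : form d := DHomog (homf k).
rewrite -(dim_vanishing_hilbert X d) leq_add2r.
have /eqP : free [tuple g k | k < r] by apply/lin_indep_free.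
rewrite size_tuple => <-.
by apply/dimvS/span_subvP => _ /mapP[k _ ->]; apply/vanishingP/f0.
Qed.

Lemma exists_lin_indep_vanishing X d r : (r + hilbert X d.+1 <= 'C(m + d, d))%N ->
  exists f : 'I_r -> {mpoly F[m.+1]}, [/\ forall k, f k \is d.-homog, lin_indep f &
    forall k, {in X, forall v, (f k).@[v] = 0}].
Proof.
rewrite -(dim_vanishing_hilbert X d) leq_add2r => /exists_free_tuple[g g_free gX].
exists (fun k => g k : {mpoly F[m.+1]}); split=> [k||k].
- exact: dhomog_is_dhomog.
- exact/lin_indep_free.
- exact/vanishingP.
Qed.

Section MaximalZeros.
Variables k d t r : nat.
Hypotheses (d_gt0 : (0 < d)%N) (lt_dq : (d < q)%N) (lt_td : (t < d)%N).
Hypothesis codim_r : (r + ('C(k + d - 1, d) + t) = 'C(m + d, d))%N.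

Lemma nzeros_leq (f : 'I_r -> {mpoly F[m.+1]}) : (k <= m.+1)%N ->
  (forall j, f j \is d.-homog) -> lin_indep f -> (nzeros f <= nproj q k + t)%N.
Proof.
move=> le_km homf indf; rewrite leqNgt; apply/negP; rewrite -addnS => lt_zeros.
have := leq_bin_hilbert le_km _ lt_td (common_zeros_sub f) lt_zeros.
have : (r + hilbert (common_zeros f) d.+1 <= 'C(m + d, d))%N.
  by apply: lin_indep_vanishing_leq homf indf _ => j v /common_zerosP[].
by rewrite d_gt0 lt_dq => le_r /(_ isT); lia.
Qed.

(* By [nzeros_leq] the forms vanishing on [linsp k] and on [t] further points have no
   other common zeros. *)
Lemma exists_nzeros : (0 < m)%N -> (k <= m)%N ->
  exists f : 'I_r -> {mpoly F[m.+1]},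
    [/\ forall j, f j \is d.-homog, lin_indep f & nzeros f = (nproj q k + t)%N].
Proof.
move=> m_gt0 le_km; have le_km1 := leqW le_km; have cardL := card_linsp F le_km1.
have [|X [sLX sX cardX]] := exists_set_between (n := nproj q k + t) (linsp_sub F m k).
  rewrite cardL leq_addr -/(Npts F m) Npts_nproj nprojSr leq_add ?nproj_mono //.
  rewrite (leq_trans (ltnW lt_td)) // (leq_trans (ltnW lt_dq)) //.
  by rewrite -[leqLHS]expn1 leq_pexp2l // (leq_trans _ lt_dq).
have leX : (r + hilbert X d.+1 <= 'C(m + d, d))%N.
  have := hilbert_leq_add d sLX; rewrite cardsDS // cardX cardL addKn.
  by have := hilbert_linsp_leq F d_gt0 le_km1; lia.
have [f [homf indf fX]] := exists_lin_indep_vanishing leX; exists f; split=> //.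
apply/eqP; rewrite eqn_leq nzeros_leq //= -cardX.
apply/subset_leq_card/subsetP => v Xv; apply/common_zerosP.
by split=> [|j]; [apply: subsetP sX v Xv | apply: fX].
Qed.

Lemma is_e_r_nproj : (0 < m)%N -> (k <= m)%N -> @is_e_r F m d r (nproj q k + t).
Proof.
move=> m_gt0 le_km; split=> [|f]; last by apply: nzeros_leq; apply: leqW.
by have [f [homf indf zf]] := exists_nzeros m_gt0 le_km; exists f.
Qed.

End MaximalZeros.

Lemma ev_is_linear : linear (@ev F m).
Proof. by move=> c p p'; apply/rowP => j; rewrite !mxE mevalD mevalZ. Qed.
HB.instance Definition _ :=
  GRing.isLinear.Build F {mpoly F[m.+1]} 'rV[F]_(Npts F m) _ (@ev F m) ev_is_linear.

Lemma ev_lin_comb r (c : 'I_r -> F) (f : 'I_r -> {mpoly F[m.+1]}) :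
  ev (\sum_(k < r) c k *: f k) = \sum_(k < r) c k *: ev (f k).
Proof. by rewrite linear_sum; apply: eq_bigr => k _; rewrite linearZ. Qed.

Lemma ev_enum_rank (p : {mpoly F[m.+1]}) v (pv : v \in pts) :
  ev p 0 (enum_rank_in pv v) = p.@[v].
Proof. by rewrite mxE enum_rankK_in. Qed.

Lemma homog_ev_eq0 d (p : {mpoly F[m.+1]}) :
  (0 < d < q)%N -> p \is d.-homog -> ev p = 0 -> p = 0.
Proof.
move=> dq homp evp0; have : DHomog homp \in vanishing pts d.
  by apply/vanishingP => v pv; rewrite /= -(ev_enum_rank p pv) evp0 mxE.
suff /eqP -> : vanishing pts d == 0%VS by rewrite memv0 => /eqP/(congr1 val).
rewrite -dimv_eq0.
have := leq_bin_hilbert (leqnn m.+1) dq (leq0n d) (subxx pts).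
rewrite addn0 -Npts_nproj => /(_ (leqnn _)); rewrite addSn subn1 succnK addn0.
by have := dim_vanishing_hilbert pts d; lia.
Qed.

Lemma free_ev_lin_indep r (f : 'I_r -> {mpoly F[m.+1]}) :
  free [tuple ev (f k) | k < r] -> lin_indep f.
Proof.
move=> /free_mktupleP ind c c0; apply: ind.
by rewrite -ev_lin_comb c0 linear0.
Qed.

Lemma lin_indep_free_ev d r (f : 'I_r -> {mpoly F[m.+1]}) :
  (forall p : {mpoly F[m.+1]}, p \is d.-homog -> ev p = 0 -> p = 0) ->
  (forall k, f k \is d.-homog) -> lin_indep f -> free [tuple ev (f k) | k < r].
Proof.
move=> ev_inj homf indf; apply/free_mktupleP => c c0; apply/indf/ev_inj.
  by apply: rpred_sum => k _; rewrite rpredZ.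
by rewrite ev_lin_comb.
Qed.

Lemma card_supp_span_ev r (f : 'I_r -> {mpoly F[m.+1]}) :
  (#|supp <<[tuple ev (f k) | k < r]>>%VS| + nzeros f = Npts F m)%N.
Proof.
set D := <<_>>%VS; rewrite -[RHS]card_ord -(cardsC (supp D)); congr addn.
rewrite -[nzeros f]/#|common_zeros f| -(card_imset _ (@enum_val_inj _ (mem pts))).
apply: eq_card => v; apply/common_zerosP/imsetP => [[pv f0]|[j jD ->]].
  exists (enum_rank_in pv v); last by rewrite enum_rankK_in.
  rewrite !inE negb_exists; apply/forallP => c; rewrite negb_and negbK -implybE.
  apply/implyP => /coord_span->; rewrite summxE big1 // => k _.
  by rewrite -tnth_nth tnth_mktuple mxE ev_enum_rank f0 mulr0.
split=> [|k]; first exact: enum_valP.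
move: jD; rewrite !inE negb_exists => /forallP/(_ (ev (f k))).
rewrite mxE negb_and negbK => /orP[/negP[]|/eqP//].
by rewrite memv_span // -(tnth_mktuple (fun k => ev (f k)) k) mem_tnth.
Qed.

Lemma PRM_span_ev d (D : {vspace 'rV[F]_(Npts F m)}) : (forall c, c \in D -> PRM d c) ->
  exists2 f : 'I_(\dim D) -> {mpoly F[m.+1]},
    forall k, f k \is d.-homog & [tuple ev (f k) | k < \dim D] = vbasis D.
Proof.
move=> D_PRM.
have /fin_all_exists[f fP] (k : 'I_(\dim D)) : exists p : {mpoly F[m.+1]},
    p \is d.-homog /\ tnth (vbasis D) k = ev p.
  by apply: D_PRM; apply: vbasis_mem; apply: mem_tnth.
exists f => [k|]; first by have [] := fP k.
by apply: eq_from_tnth => k; rewrite tnth_mktuple; have [_ ->] := fP k.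
Qed.

(* Subspaces of the code of dimension [r] correspond to systems of [r] linearly
   independent forms, and the support is the complement of the common zeros. *)
Lemma is_ghw_PRM d r e :
  (forall p : {mpoly F[m.+1]}, p \is d.-homog -> ev p = 0 -> p = 0) ->
  is_e_r F m d r e -> is_ghw (@PRM F m d) r (Npts F m - e).
Proof.
move=> ev_inj [[f [homf [indf zf]]] max_e]; split=> [|D dimD D_PRM].
  exists <<[tuple ev (f k) | k < r]>>%VS; split; [|split] => [|c|].
  - by have /eqP := lin_indep_free_ev ev_inj homf indf; rewrite size_tuple.
  - move=> /coord_span cE; exists (\sum_(k < r) coord [tuple ev (f k) | k < r] k c *: f k).
    split; first by apply: rpred_sum => k _; apply/rpredZ/homf.
    rewrite ev_lin_comb [LHS]cE; apply: eq_bigr => k _.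
    by rewrite -tnth_nth tnth_mktuple.
  - by have := card_supp_span_ev f; rewrite zf; lia.
have {D_PRM} [g homg gD] := PRM_span_ev D_PRM; rewrite -dimD in max_e.
have indg : lin_indep g by apply: free_ev_lin_indep; rewrite gD (basis_free (vbasisP D)).
have := card_supp_span_ev g; rewrite gD (span_basis (vbasisP D)).
by have := max_e g homg indg; lia.
Qed.

End Systems.

Local Close Scope ring_scope.

Theorem theorem6p4 (F : finFieldType) (m d i t : nat) :
  (1 <= m)%N -> (1 <= d)%N -> (d < #|F|)%N ->
  (1 <= i <= m.+1)%N -> (t < d)%N ->
  let q := #|F| in
  let r := ((\sum_(1 <= a < i.+1) 'C(m + d - a, d - 1)) - t)%N in
  @is_e_r F m d r (pj q (m%:Z - i%:Z) + t)%N /\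
  @is_ghw F (Npts F m) (@PRM F m d) r (pj q m%:Z - pj q (m%:Z - i%:Z) - t)%N.
Proof.
move=> m_gt0 d_gt0 lt_dq /andP[i_gt0 le_im] lt_td q r.
have codim_r : r + ('C(m.+1 - i + d - 1, d) + t) = 'C(m + d, d).
  rewrite -(sum_bin_codim d_gt0 le_im) /r.
  by have := leq_sum_bin m_gt0 d_gt0 i_gt0; lia.
have e_r : is_e_r F m d r (pj q (m%:Z - i%:Z) + t).
  by rewrite pj_nproj //; apply: is_e_r_nproj; lia.
have -> : pj q m%:Z = Npts F m by rewrite Npts_nproj.
split=> //; rewrite -subnDA; apply: is_ghw_PRM e_r => p homp.
by apply: homog_ev_eq0 homp; rewrite d_gt0.
Qed.
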